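(* Let $N,n,m,p$ be positive integers, $A\in\mathbb R^{n\times n}$, $B\in\mathbb R^{n\times m}$, $C\in\mathbb R^{p\times n}$. Suppose that $(\hat P,\hat{\mathcal J},\hat{\mathcal G})$ is a solution of the state-feedback LMI $$\mathcal X_N(P,1)+\mathrm{He}\left\{(\mathcal L_N^T\otimes A)\mathcal G(\mathcal R_N\otimes\mathbf I_n)+(\mathcal L_N^T\otimes B)\mathcal J(\mathcal R_N\otimes\mathbf I_n)-(\mathcal R_N^T\otimes\mathbf I_n)\mathcal G(\mathcal R_N\otimes\mathbf I_n)\right\}\prec0$$ in the unknowns $P=P^T\in\mathbb R^{n\times n}$, $\mathcal J\in\mathbb R^{Nm\times Nn}$ block upper triangular with $m\times n$ blocks, and $\mathcal G\in\mathbb R^{Nn\times Nn}$ block upper triangular with $n\times n$ blocks, and let $\hat{\mathcal F}_{\mathrm{SF}}=(\mathbf T_N\otimes\mathbf I_m)\hat{\mathcal J}\hat{\mathcal G}^{-1}(\mathbf T_N\otimes\mathbf I_n)$. Suppose there exist $P=P^T\in\mathbb R^{n\times n}$, a block lower triangular matrix $\mathcal M\in\mathbb R^{Nm\times Np}$ with $m\times p$ blocks, a block lower triangular matrix $\mathcal V_{11}\in\mathbb R^{Nm\times Nm}$ with $m\times m$ blocks, $\mathcal V_{12}\in\mathbb R^{Nm\times(N-1)n}$ and $\mathcal V_{22}\in\mathbb R^{(N-1)n\times(N-1)n}$ such that, with $\gamma=1$, $$P\succ0,$$ $$\Pi_N^T\,\mathcal X_N(P,\gamma)\,\Pi_N+\mathrm{He}\{\mathcal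 H(\hat{\mathcal F}_{\mathrm{SF}})^T\,\mathcal D(\mathcal M,\mathcal V_{11},\mathcal V_{12},\mathcal V_{22})\}\prec0,$$ $$\mathrm{He}\{\mathcal V_{11}\}\prec0 .$$ Then the system $x(k+1)=Ax(k)+Bu(k)$, $y(k)=Cx(k)$ is stabilizable via an $N$-periodic time-varying memory static output feedback controller $$u(k)=\sum_{i=0}^{\lceil k\rceil_N}F_{\mathrm{SOF}}^{(\lceil k\rceil_N,i)}y(k-i)$$ (i.e. for some gains the closed-loop system is asymptotically stable), and an admissible (stabilizing) gain matrix is $\mathcal F_{\mathrm{SOF}}=\mathcal V_{11}^{-1}\mathcal M$.
   Context: Notation: $k\in\mathbb N$ (nonnegative integers); $\lceil k\rceil_N$ denotes the remainder of $k$ divided by $N$; $\mathrm{He}\{X\}=X^T+X$; $\otimes$ is the Kronecker product; $\mathbf I_q$ is the $q\times q$ identity; $\mathbf 0$ is a zero matrix of appropriate size; $\mathbf e_{(q,i)}\in\mathbb R^q$ is the $i$-th standard unit column vector; $\succ0$ ($\prec0$) means symmetric positive (negative) definite. $\mathcal L_q=[\mathbf I_q\ \ \mathbf 0_q]$ and $\mathcal R_q=[\mathbf 0_q\ \ \mathbf I_q]$, both in $\mathbb R^{q\times(q+1)}$, with $\mathbf 0_q$ the zero column vector (for $q=0$ these are empty and the corresponding blocks are absent). $\mathbf T_N\in\mathbb R^{N\times N}$ is the exchange matrix (ones on the anti-diagonal, zeros elsewhere). Any $\hat{\mathcal G}$ in a solution of the state-feedback LMI is invertible. The gain matrix $\mathcal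 F_{\mathrm{SOF}}$ collects the gains $F_{\mathrm{SOF}}^{(k,i)}\in\mathbb R^{m\times p}$, $0\le i\le k\le N-1$, in the block lower triangular form $$\mathcal F_{\mathrm{SOF}}=\begin{bmatrix}F_{\mathrm{SOF}}^{(0,0)}&\mathbf 0&\cdots&\mathbf 0\\ F_{\mathrm{SOF}}^{(1,1)}&F_{\mathrm{SOF}}^{(1,0)}&\ddots&\vdots\\ \vdots&\ddots&\ddots&\mathbf 0\\ F_{\mathrm{SOF}}^{(N-1,N-1)}&\cdots&F_{\mathrm{SOF}}^{(N-1,1)}&F_{\mathrm{SOF}}^{(N-1,0)}\end{bmatrix}\in\mathbb R^{Nm\times Np}.$$ Further matrices: $$\mathcal X_N(P,\gamma)=\bigl(-\gamma\,\mathbf e_{(N+1,1)}\mathbf e_{(N+1,1)}^T+\mathbf e_{(N+1,N+1)}\mathbf e_{(N+1,N+1)}^T\bigr)\otimes P,$$ $$\Pi_N=\begin{bmatrix}\mathbf e_{(N,1)}^T\otimes\mathbf I_n&\mathbf 0_{n\times Nm}\\ \mathbf I_N\otimes A&\mathbf I_N\otimes B\end{bmatrix},$$ $$\mathcal H(\hat{\mathcal F}_{\mathrm{SF}})=\begin{bmatrix}\hat{\mathcal F}_{\mathrm{SF}}&-\mathbf I_N\otimes\mathbf I_m\\ \mathcal L_{N-1}\otimes A-\mathcal R_{N-1}\otimes\mathbf I_n&\mathcal L_{N-1}\otimes B\end{bmatrix},$$ $$\mathcal D(\mathcal M,\mathcal V_{11},\mathcal V_{12},\mathcal V_{22})=\begin{bmatrix}\mathcal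 M(\mathbf I_N\otimes C)+\mathcal V_{12}(\mathcal L_{N-1}\otimes A)-\mathcal V_{12}(\mathcal R_{N-1}\otimes\mathbf I_n)&-\mathcal V_{11}+\mathcal V_{12}(\mathcal L_{N-1}\otimes B)\\ \mathcal V_{22}(\mathcal L_{N-1}\otimes A)-\mathcal V_{22}(\mathcal R_{N-1}\otimes\mathbf I_n)&\mathcal V_{22}(\mathcal L_{N-1}\otimes B)\end{bmatrix}.$$ *)

(* Defs.v *)
From mathcomp Require Export all_boot all_order all_algebra.
From mathcomp Require Export mxtens.
From mathcomp Require Export all_classical all_reals all_analysis.

Set Implicit Arguments.
Unset Strict Implicit.
Unset Printing Implicit Defensive.

Import Order.TTheory GRing.Theory Num.Theory.
Import numFieldNormedType.Exports.

Local Open Scope classical_set_scope.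
Local Open Scope ring_scope.

(* Kronecker products are [A *t B] of mxtens: the entry of row (i, k) and
   column (j, l) is A i j * B k l, where (i, k) is encoded by
   [mxtens_index (i, k)], of value i * (number of rows of B) + k.  Matrices
   of type 'M_(q * a, r * b) are thus q x r block matrices with a x b blocks. *)

Section MatrixNotions.
Context {R : realType}.

Definition He q (X : 'M[R]_q) : 'M[R]_q := X^T + X.

Definition posdef q (X : 'M[R]_q) : Prop :=
  X^T = X /\ forall v : 'cV[R]_q, v != 0 -> 0 < (v^T *m X *m v) 0 0.

Definition negdef q (X : 'M[R]_q) : Prop :=
  X^T = X /\ forall v : 'cV[R]_q, v != 0 -> (v^T *m X *m v) 0 0 < 0.

Definition block q r a b (X : 'M[R]_(q * a, r * b)) (i : 'I_q) (j : 'I_r) :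
    'M[R]_(a, b) :=
  mxsub (fun k => mxtens_index (i, k)) (fun l => mxtens_index (j, l)) X.

Definition block_lower_triangular q r a b (X : 'M[R]_(q * a, r * b)) : Prop :=
  forall (i : 'I_q) (j : 'I_r), (i < j)%N -> block X i j = 0.

Definition block_upper_triangular q r a b (X : 'M[R]_(q * a, r * b)) : Prop :=
  forall (i : 'I_q) (j : 'I_r), (j < i)%N -> block X i j = 0.

(* The index [i] is counted from 1. *)
Definition unit_col q (i : nat) : 'cV[R]_q := \col_(j < q) (j.+1 == i)%:R.

(* [Lmx q r] = [I_q 0] and [Rmx q r] = [0 I_q] are only used for r = q + 1;
   r is kept separate so that, for N > 0, [Lmx N.-1 N] needs no cast. *)
Definition Lmx q r : 'M[R]_(q, r) := \matrix_(i, j) (val j == i)%:R.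
Definition Rmx q r : 'M[R]_(q, r) := \matrix_(i, j) (val j == i.+1)%:R.

Definition exchange_mx q : 'M[R]_q := \matrix_(i, j) (j == rev_ord i)%:R.

End MatrixNotions.

Section LMI.
Context {R : realType} (N : nat) {n m p : nat}.
Variables (A : 'M[R]_n) (B : 'M[R]_(n, m)) (C : 'M[R]_(p, n)).

Definition Xmx (P : 'M[R]_n) (gamma : R) : 'M[R]_(N.+1 * n) :=
  (- (gamma *: (unit_col N.+1 1 *m (unit_col N.+1 1)^T))
   + unit_col N.+1 N.+1 *m (unit_col N.+1 N.+1)^T) *t P.

(* The two block rows have heights 1 * n and N * n; the cast only merges them
   into N.+1 * n. *)
Definition Pimx : 'M[R]_(N.+1 * n, N * n + N * m) :=
  castmx (esym (mulnDl 1 N n), erefl)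
    (block_mx ((unit_col N 1)^T *t (1%:M : 'M[R]_n))
              (0 : 'M[R]_(1 * n, N * m))
              ((1%:M : 'M[R]_N) *t A)
              ((1%:M : 'M[R]_N) *t B)).

Definition sf_lmi_mx (P : 'M[R]_n) (J : 'M[R]_(N * m, N * n))
    (G : 'M[R]_(N * n)) : 'M[R]_(N.+1 * n) :=
  let L := Lmx N N.+1 in
  let RI := Rmx N N.+1 *t (1%:M : 'M[R]_n) in
  Xmx P 1
  + He (L^T *t A *m G *m RI
        + L^T *t B *m J *m RI
        - (Rmx N N.+1)^T *t (1%:M : 'M[R]_n) *m G *m RI).

Definition sf_lmi_solution (P : 'M[R]_n) (J : 'M[R]_(N * m, N * n))
    (G : 'M[R]_(N * n)) : Prop :=
  [/\ P^T = P, block_upper_triangular J, block_upper_triangular G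
    & negdef (sf_lmi_mx P J G)].

(* [invmx G] is the genuine inverse: G is invertible in every solution. *)
Definition sf_gain_mx (J : 'M[R]_(N * m, N * n)) (G : 'M[R]_(N * n)) :
    'M[R]_(N * m, N * n) :=
  exchange_mx N *t (1%:M : 'M[R]_m) *m J *m invmx G
  *m (exchange_mx N *t (1%:M : 'M[R]_n)).

Definition Hmx (F : 'M[R]_(N * m, N * n)) :
    'M[R]_(N * m + N.-1 * n, N * n + N * m) :=
  block_mx F
           (- ((1%:M : 'M[R]_N) *t (1%:M : 'M[R]_m)))
           (Lmx N.-1 N *t A - Rmx N.-1 N *t (1%:M : 'M[R]_n))
           (Lmx N.-1 N *t B).

Definition Dmx (M : 'M[R]_(N * m, N * p)) (V11 : 'M[R]_(N * m))
    (V12 : 'M[R]_(N * m, N.-1 * n)) (V22 : 'M[R]_(N.-1 * n)) :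
    'M[R]_(N * m + N.-1 * n, N * n + N * m) :=
  let LA := Lmx N.-1 N *t A in
  let LB := Lmx N.-1 N *t B in
  let RI := Rmx N.-1 N *t (1%:M : 'M[R]_n) in
  block_mx (M *m ((1%:M : 'M[R]_N) *t C) + V12 *m LA - V12 *m RI)
           (- V11 + V12 *m LB)
           (V22 *m LA - V22 *m RI)
           (V22 *m LB).

End LMI.

Arguments sf_lmi_solution {R} N {n m} A B P J G.
Arguments Hmx {R} N {n m} A B F.
Arguments Dmx {R} N {n m p} A B C M V11 V12 V22.
Arguments sf_gain_mx {R} N {n m} J G.

Section Controller.
Context {R : realType} (N : nat) {n m p : nat}.
Variables (A : 'M[R]_n) (B : 'M[R]_(n, m)) (C : 'M[R]_(p, n)).

(* [F k i] is the gain F^(k,i); only the values with i <= k < N matter. *)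
Definition sof_gain_mx (F : nat -> nat -> 'M[R]_(m, p)) :
    'M[R]_(N * m, N * p) :=
  \matrix_(a, b)
    let: (k, c) := mxtens_unindex a in
    let: (j, d) := mxtens_unindex b in
    if (j <= k)%N then F k (k - j)%N c d else 0.

Definition sof_control (F : nat -> nat -> 'M[R]_(m, p)) (x : nat -> 'cV[R]_n)
    (k : nat) : 'cV[R]_m :=
  \sum_(i < (k %% N).+1) F (k %% N)%N i *m (C *m x (k - i)%N).

Definition closed_loop_from (k0 : nat) (F : nat -> nat -> 'M[R]_(m, p))
    (x : nat -> 'cV[R]_n) : Prop :=
  forall k, (k0 <= k)%N -> x k.+1 = A *m x k + B *m sof_control F x k.

(* Lyapunov stability and attractivity at every initial time k0.  The memory
   of the controller at time k0 consists of x (k0 - j) for j <= k0 %% N, which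
   is x 0 alone for k0 = 0; these values are the initial condition. *)
Definition asymptotically_stable (F : nat -> nat -> 'M[R]_(m, p)) : Prop :=
  (forall (k0 : nat) (eps : R), 0 < eps ->
     exists2 delta : R, 0 < delta &
       forall x, closed_loop_from k0 F x ->
         (forall j, (j <= k0 %% N)%N -> `|x (k0 - j)%N| < delta) ->
         forall k, (k0 <= k)%N -> `|x k| < eps)
  /\ (forall (k0 : nat) x, closed_loop_from k0 F x ->
        x @ \oo --> (0 : 'cV[R]_n)).

Definition periodic_sof_stabilizable : Prop :=
  exists F : nat -> nat -> 'M[R]_(m, p), asymptotically_stable F.

Definition stabilizing_gain_mx (Fmx : 'M[R]_(N * m, N * p)) : Prop :=
  exists2 F : nat -> nat -> 'M[R]_(m, p),
    Fmx = sof_gain_mx F & asymptotically_stable F.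

End Controller.

Arguments stabilizing_gain_mx {R} N {n m p} A B C Fmx.

(* Main.v *)
Require Import Defs.
From mathcomp Require Import ring lra.
Import Order.TTheory GRing.Theory Num.Theory.
Import numFieldNormedType.Exports.
Local Open Scope ring_scope.

(** The function W x = x^T P x decreases along the closed loop, not at every
    step but over every full period, and the LMI is a certificate of that.

    Stack the states X = (x_0, ..., x_(N-1)) and inputs U = (u_0, ..., u_(N-1))
    of one period.  With F = V11^-1 M, the feedback law reads V11 U = M Y,
    where Y = (C x_0, ..., C x_(N-1)), and together with the N - 1 internal
    state equations it gives D (X, U) = 0 ([Dmx_trajectory]).  On such vectors
    the term He (H^T D) of the LMI vanishes, and what remains is the quadratic
    form of Pi^T X_N(P, 1) Pi, namely W(x_N) - W(x_0).  By coercivity, the LMI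
    thus gives W(x_N) <= W(x_0) - c |(X, U)|^2 for some c > 0
    ([posdef_coercive], [lmi_dissipation]).

    This has two consequences.  At period boundaries W is comparable with
    |x|^2, so it decays geometrically.  Inside a period, c |x_j|^2 <= W(x_0)
    because |(X, U)| dominates every |x_j| and W(x_N) >= 0
    ([periodic_decay]).  For a start in the middle of a period, the
    finitely many steps before the next boundary amplify the stored states by
    at most a constant factor ([finite_horizon_bound]).  Both bounds are linear
    in the initial data, whence stability and attractivity.

    Finally, V11^-1 M must be a legitimate gain matrix, i.e. V11 must be
    invertible and V11^-1 M block lower triangular.  Both hold because the
    quadratic form of V11 vanishes only at 0
    ([unitmx_qform_neq0], [block_lower_triangular_divl]). *)

Set Implicit Arguments.
Unset Strict Implicit.
Unset Printing Implicit Defensive.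

(** * Quadratic forms and the maximum norm *)

Section QuadraticForms.
Context {R : realType}.

Definition qform q (Q : 'M[R]_q) (v : 'cV[R]_q) : R := (v^T *m Q *m v) 0 0.

Lemma qformD q (Q1 Q2 : 'M[R]_q) v :
  qform (Q1 + Q2) v = qform Q1 v + qform Q2 v.
Proof. by rewrite /qform mulmxDr mulmxDl mxE. Qed.

Lemma qformN q (Q : 'M[R]_q) v : qform (- Q) v = - qform Q v.
Proof. by rewrite /qform mulmxN mulNmx mxE. Qed.

Lemma qform_tr q (Q : 'M[R]_q) v : qform Q^T v = qform Q v.
Proof.
have -> : qform Q v = ((v^T *m Q *m v)^T) 0 0 by rewrite mxE.
by rewrite !trmx_mul trmxK mulmxA.
Qed.

Lemma qform_He q (Q : 'M[R]_q) v : qform (He Q) v = qform Q v *+ 2.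
Proof. by rewrite /He qformD qform_tr mulr2n. Qed.

Lemma qform0r q (Q : 'M[R]_q) : qform Q 0 = 0.
Proof. by rewrite /qform mulmx0 mxE. Qed.

(** A kernel vector is isotropic. *)
Lemma unitmx_qform_neq0 q (Q : 'M[R]_q) :
  (forall v, v != 0 -> qform Q v != 0) -> Q \in unitmx.
Proof.
move=> Q_def; rewrite unitmxE unitfE; apply/negP => /det0P[v v0 vQ].
have /Q_def : v^T != 0.
  by apply: contra_neq v0 => /(congr1 trmx); rewrite trmxK trmx0.
by rewrite /qform trmxK vQ mul0mx mxE eqxx.
Qed.

Lemma posdef_ge0 q (Q : 'M[R]_q) v : posdef Q -> 0 <= qform Q v.
Proof.
case=> _ Q_pos; have [->|v0] := eqVneq v 0; first by rewrite qform0r.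
exact/ltW/Q_pos.
Qed.

(** Evaluate the form at (v^T Q v) u - (u^T Q v) v. *)
Lemma posdef_cauchy_schwarz q (Q : 'M[R]_q) (u v : 'cV[R]_q) : posdef Q ->
  ((u^T *m Q *m v) 0 0) ^+ 2 <= qform Q u * qform Q v.
Proof.
move=> Q_pos; have [->|v0] := eqVneq v 0.
  by rewrite mulmx0 qform0r mxE mulr0 expr0n.
have c_gt0 : 0 < qform Q v by case: Q_pos => _; apply.
set b := (u^T *m Q *m v) 0 0; set c := qform Q v in c_gt0 *.
have b_sym : (v^T *m Q *m u) 0 0 = b.
  have -> : b = ((u^T *m Q *m v)^T) 0 0 by rewrite mxE.
  by rewrite !trmx_mul trmxK mulmxA; case: Q_pos => ->.
have := posdef_ge0 (c *: u - b *: v) Q_pos.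
have -> : qform Q (c *: u - b *: v) =
    c * (c * qform Q u) - b * (c * b) - (c * (b * b) - b * (b * c)).
  have trE : (c *: u - b *: v)^T = c *: u^T - b *: v^T.
    by rewrite linearB !linearZ.
  rewrite {1}/qform trE !(mulmxBl, mulmxBr) -!(scalemxAl, scalemxAr).
  have subE (X Y : 'M[R]_1) : (X - Y) 0 0 = X 0 0 - Y 0 0 by rewrite !mxE.
  have scaleE a (X : 'M[R]_1) : (a *: X) 0 0 = a * X 0 0 by rewrite mxE.
  by rewrite !(subE, scaleE) b_sym -/(qform Q u) -/(qform Q v) -/b -/c; ring.
have -> : c * (c * qform Q u) - b * (c * b) - (c * (b * b) - b * (b * c)) =
   c * (qform Q u * c - b ^+ 2).
  by rewrite -/c; ring.
by rewrite pmulr_rge0 // subr_ge0.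
Qed.

Lemma normcV_le q (v : 'cV[R]_q) (r : R) : 0 <= r ->
  (forall i, `|v i 0| <= r) -> `|v| <= r.
Proof.
move=> r0 vr; rewrite [leLHS]/Num.Def.normr/= mx_normrE.
rewrite bigmax_le //= => -[i j] _.
by rewrite ord1.
Qed.

Lemma normcV_ge q (v : 'cV[R]_q) i : `|v i 0| <= `|v|.
Proof.
rewrite [leRHS]/Num.Def.normr/= mx_normrE.
exact: (le_bigmax _ (fun ij : 'I_q * 'I_1 => `|v ij.1 ij.2|) (i, 0)).
Qed.

(** Cauchy-Schwarz for Q, applied to v and u_i = Q^-1 e_i, bounds the coordinate
    v_i = u_i^T Q v:  v_i^2 <= (u_i^T Q u_i) (v^T Q v). *)
Lemma posdef_coercive q (Q : 'M[R]_q) : posdef Q ->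
  exists2 c : R, 0 < c & forall v, c * `|v| ^+ 2 <= qform Q v.
Proof.
move=> Q_pos; have [Q_sym Q_gt0] := Q_pos.
have Q_unit : Q \in unitmx.
  by apply: unitmx_qform_neq0 => v /Q_gt0; apply: lt0r_neq0.
pose u (i : 'I_q) : 'cV[R]_q := invmx Q *m delta_mx i 0.
pose c := 1 + \sum_i qform Q (u i).
have c_gt0 : 0 < c by rewrite ltr_pwDl // sumr_ge0 // => i _; apply: posdef_ge0.
exists c^-1; first by rewrite invr_gt0.
move=> v; rewrite mulrC ler_pdivrMr // mulrC.
have v_le i : (v i 0) ^+ 2 <= c * qform Q v.
  have -> : v i 0 = ((u i)^T *m Q *m v) 0 0.
    rewrite /u trmx_mul -{2}Q_sym -(mulmxA _ (invmx Q)^T) -trmx_mul mulmxV //.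
    by rewrite trmx1 mulmx1 trmx_delta -rowE mxE.
  apply: le_trans (posdef_cauchy_schwarz _ _ Q_pos) _.
  rewrite ler_wpM2r ?posdef_ge0 // /c (bigD1 i) //= addrCA lerDl.
  by rewrite addr_ge0 // sumr_ge0 // => j _; apply: posdef_ge0.
have cQ_ge0 : 0 <= c * qform Q v by rewrite mulr_ge0 ?posdef_ge0 // ltW.
rewrite -[leRHS]sqr_sqrtr // lerXn2r ?nnegrE // normcV_le // => i.
by rewrite -sqrtr_sqr ler_wsqrtr.
Qed.

(** A crude bound on the operator norm; being explicit, it can be summed over
    the gains of a controller. *)
Definition entry_norm_sum q r (X : 'M[R]_(q, r)) : R :=
  \sum_i \sum_j `|X i j|.

Lemma entry_norm_sum_ge0 q r (X : 'M[R]_(q, r)) : 0 <= entry_norm_sum X.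
Proof. by do 2!apply: sumr_ge0 => ? _. Qed.

Lemma norm_mulmx_le q r (X : 'M[R]_(q, r)) (v : 'cV[R]_r) :
  `|X *m v| <= entry_norm_sum X * `|v|.
Proof.
apply: normcV_le => [|i]; first by rewrite mulr_ge0 ?entry_norm_sum_ge0.
rewrite mxE /entry_norm_sum (bigD1 i) //= mulrDl ler_wpDr //.
  by rewrite mulr_ge0 // sumr_ge0 // => ? _; rewrite sumr_ge0.
rewrite mulr_suml (le_trans (ler_norm_sum _ _ _)) // ler_sum // => j _.
by rewrite normrM ler_wpM2l // normcV_ge.
Qed.

Lemma qform_le q (Q : 'M[R]_q) :
  exists2 c : R, 0 <= c & forall v, qform Q v <= c * `|v| ^+ 2.
Proof.
exists (q%:R * entry_norm_sum Q) => [|v].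
  by rewrite mulr_ge0 ?entry_norm_sum_ge0.
rewrite /qform -mulmxA mxE -[q in q%:R]card_ord -sum1_card natr_sum -mulrA.
rewrite mulr_suml ler_sum // => i _; rewrite mul1r mxE (le_trans (ler_norm _)) //.
rewrite normrM mulrC expr2 mulrA ler_pM //; last exact: normcV_ge.
exact: le_trans (normcV_ge _ _) (norm_mulmx_le _ _).
Qed.

End QuadraticForms.

(** * Block vectors and Kronecker products *)

Section BlockVectors.
Context {R : realType}.

Definition vblock q a (w : 'cV[R]_(q * a)) (i : 'I_q) : 'cV[R]_a :=
  \col_k w (mxtens_index (i, k)) 0.

Definition vstack q a (f : 'I_q -> 'cV[R]_a) : 'cV[R]_(q * a) :=
  \col_k f (mxtens_unindex k).1 (mxtens_unindex k).2 0.

Lemma vstackK q a (f : 'I_q -> 'cV[R]_a) i : vblock (vstack f) i = f i.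
Proof. by apply/colP => k; rewrite !mxE mxtens_indexK. Qed.

Lemma vblockP q a (w z : 'cV[R]_(q * a)) :
  (forall i, vblock w i = vblock z i) -> w = z.
Proof.
move=> wz; apply/colP => k; case: (mxtens_indexP k) => i j.
by have /colP/(_ j) := wz i; rewrite !mxE.
Qed.

Lemma vblockD q a (w z : 'cV[R]_(q * a)) i :
  vblock (w + z) i = vblock w i + vblock z i.
Proof. by apply/colP => k; rewrite !mxE. Qed.

Lemma vblockN q a (w : 'cV[R]_(q * a)) i : vblock (- w) i = - vblock w i.
Proof. by apply/colP => k; rewrite !mxE. Qed.

Lemma vblock0 q a (i : 'I_q) : vblock (0 : 'cV[R]_(q * a)) i = 0.
Proof. by apply/colP => k; rewrite !mxE. Qed.

Lemma sum_mxtens q a (V : nmodType) (f : 'I_(q * a) -> V) :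
  \sum_k f k = \sum_i \sum_j f (mxtens_index (i, j)).
Proof.
rewrite pair_bigA (reindex (@mxtens_index q a)) /=; last first.
  by exists (@mxtens_unindex q a) => k _; rewrite (mxtens_indexK, mxtens_unindexK).
by apply: eq_bigr => -[].
Qed.

Lemma vblock_mulmx q r a b (X : 'M[R]_(q * a, r * b)) w i :
  vblock (X *m w) i = \sum_j block X i j *m vblock w j.
Proof.
apply/colP => k; rewrite !mxE sum_mxtens summxE; apply: eq_bigr => j _.
by rewrite mxE; apply: eq_bigr => l _; rewrite !mxE.
Qed.

Lemma block_tensmx q r a b (S : 'M[R]_(q, r)) (Y : 'M[R]_(a, b)) i j :
  block (S *t Y) i j = S i j *: Y.
Proof. by apply/matrixP => k l; rewrite !mxE !mxtens_indexK. Qed.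

Lemma vblock_tensmx q r a b (S : 'M[R]_(q, r)) (Y : 'M[R]_(a, b)) w i :
  vblock (S *t Y *m w) i = \sum_j S i j *: (Y *m vblock w j).
Proof.
by rewrite vblock_mulmx; apply: eq_bigr => j _; rewrite block_tensmx scalemxAl.
Qed.

Lemma vblock_tens1mx q a b (Y : 'M[R]_(a, b)) (w : 'cV[R]_(q * b)) i :
  vblock (1%:M *t Y *m w) i = Y *m vblock w i.
Proof.
rewrite vblock_tensmx (bigD1 i) //= big1 ?addr0 => [|j ji].
  by rewrite mxE eqxx scale1r.
by rewrite mxE eq_sym (negPf ji) scale0r.
Qed.

Lemma dot_vblock q a (w z : 'cV[R]_(q * a)) :
  w^T *m z = \sum_i (vblock w i)^T *m vblock z i.
Proof.
apply/matrixP => i j; rewrite !ord1 mxE sum_mxtens summxE.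
by apply: eq_bigr => k _; rewrite mxE; apply: eq_bigr => l _; rewrite !mxE.
Qed.

Lemma vblock_norm_le q a (w : 'cV[R]_(q * a)) i : `|vblock w i| <= `|w|.
Proof. by apply: normcV_le => // k; rewrite mxE normcV_ge. Qed.

Lemma col_mx_norm_le a b (u : 'cV[R]_a) (v : 'cV[R]_b) :
  `|u| <= `|col_mx u v|.
Proof.
apply: normcV_le => // k.
by rewrite -(col_mxEu u v) normcV_ge.
Qed.

End BlockVectors.

Section LmiBlocks.
Context {R : realType}.

Lemma vblock_Lmx q a b (Y : 'M[R]_(a, b)) (w : 'cV[R]_(q.+1 * b)) (i : 'I_q) :
  vblock (Lmx q q.+1 *t Y *m w) i = Y *m vblock w (widen_ord (leqnSn q) i).
Proof.
rewrite vblock_tensmx (bigD1 (widen_ord (leqnSn q) i)) //= big1 ?addr0.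
  by rewrite mxE eqxx scale1r.
by move=> j ji; rewrite mxE (negPf (ji : val j != i)) scale0r.
Qed.

Lemma vblock_Rmx q a b (Y : 'M[R]_(a, b)) (w : 'cV[R]_(q.+1 * b)) (i : 'I_q) :
  vblock (Rmx q q.+1 *t Y *m w) i = Y *m vblock w (lift ord0 i).
Proof.
rewrite vblock_tensmx (bigD1 (lift ord0 i)) //= big1 ?addr0.
  by rewrite mxE eqxx scale1r.
by move=> j ji; rewrite mxE (negPf (ji : val j != i.+1)) scale0r.
Qed.

Lemma qform_tensmx q a (S : 'M[R]_q) (P : 'M[R]_a) (w : 'cV[R]_(q * a)) :
  qform (S *t P) w =
  \sum_i \sum_j S i j * ((vblock w i)^T *m P *m vblock w j) 0 0.
Proof.
rewrite /qform -mulmxA dot_vblock summxE; apply: eq_bigr => i _.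
rewrite vblock_tensmx mulmx_sumr summxE; apply: eq_bigr => j _.
by rewrite -scalemxAr mulmxA mxE.
Qed.

Lemma qform_Xmx q a (P : 'M[R]_a) (w : 'cV[R]_(q.+1 * a)) :
  qform (Xmx q P 1) w = qform P (vblock w ord_max) - qform P (vblock w ord0).
Proof.
have XE (i j : 'I_q.+1) : (- (1 *: (unit_col q.+1 1 *m (unit_col q.+1 1)^T))
    + unit_col q.+1 q.+1 *m (unit_col q.+1 q.+1)^T) i j =
    ((i == ord_max) && (j == ord_max))%:R - ((i == ord0) && (j == ord0))%:R :> R.
  by rewrite scale1r !mxE !big_ord1 !mxE !eqSS -!natrM !mulnb addrC.
have sumE (k : 'I_q.+1) (f : 'I_q.+1 -> 'I_q.+1 -> R) :
    \sum_i \sum_j ((i == k) && (j == k))%:R * f i j = f k k.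
  rewrite (bigD1 k) //= (bigD1 k) //= eqxx mul1r !big1 ?addr0 // => i ik.
    by rewrite big1 // => j _; rewrite (negPf ik) mul0r.
  by rewrite (negPf ik) mul0r.
rewrite qform_tensmx.
under eq_bigr => i _ do under eq_bigr => j _ do rewrite XE mulrBl.
under eq_bigr => i _ do rewrite sumrB.
by rewrite sumrB !sumE.
Qed.

(** The cast in the definition of [Pimx] only relabels indices: the first block
    comes from the upper vector, the others from the lower one. *)
Lemma vblock_cast_col q a (u : 'cV[R]_(1 * a)) (w : 'cV[R]_(q * a))
    (i : 'I_q.+1) :
  vblock (castmx (esym (mulnDl 1 q a), erefl) (col_mx u w) : 'cV_(q.+1 * a)) i =
  if unlift ord0 i is Some j then vblock w j else vblock u ord0.
Proof.
apply/colP => k; rewrite mxE castmxE cast_ord_id.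
case: unliftP => [j|] ->.
  transitivity (col_mx u w (rshift (1 * a) (mxtens_index (j, k))) 0).
    congr (fun_of_matrix _ _ _); apply: val_inj => /=.
    by rewrite /bump /= add1n mulSn mul1n addnA.
  by rewrite col_mxEd mxE.
transitivity (col_mx u w (lshift (q * a) (mxtens_index (ord0, k))) 0).
  by congr (fun_of_matrix _ _ _); apply: val_inj.
by rewrite col_mxEu mxE.
Qed.

End LmiBlocks.

(** * Block lower triangular gain matrices *)

Section Triangular.
Context {R : realType}.

Lemma block_lower_triangular_entry q a b (X : 'M[R]_(q * a, q * b)) c d :
  block_lower_triangular X ->
  ((mxtens_unindex c).1 < (mxtens_unindex d).1)%N -> X c d = 0.
Proof.
case: (mxtens_indexP c) => i k; case: (mxtens_indexP d) => j l X_lower.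
rewrite !mxtens_indexK /= => /X_lower/matrixP/(_ k l).
by rewrite !mxE.
Qed.

(** Take a column of F in block column j and keep only the blocks above j, which
    should be 0; call the result z.  On the blocks where z lives, V z agrees
    with the column of V F because V is block lower triangular, hence vanishes.
    So z^T V z = 0 and z = 0. *)
Lemma block_lower_triangular_divl q a b (V : 'M[R]_(q * a))
    (F : 'M[R]_(q * a, q * b)) :
  (forall v, v != 0 -> qform V v != 0) ->
  block_lower_triangular V -> block_lower_triangular (V *m F) ->
  block_lower_triangular F.
Proof.
move=> V_def V_lower VF_lower i j ij; apply/matrixP => k l; rewrite !mxE.
set col := mxtens_index (j, l).
pose z : 'cV[R]_(q * a) :=
  \col_c if ((mxtens_unindex c).1 < j)%N then F c col else 0.
suff z0 : z = 0.
  have /colP/(_ (mxtens_index (i, k))) := z0.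
  by rewrite !mxE mxtens_indexK /= ij.
apply/eqP; apply: contraT => /V_def/negP[]; apply/eqP.
rewrite /qform -mulmxA mxE big1 // => c _; rewrite mxE [z c 0]mxE.
case: ifP => [cj|_]; last by rewrite mul0r.
suff -> : (V *m z) c 0 = (V *m F) c col.
  by rewrite (block_lower_triangular_entry VF_lower) ?mulr0 // mxtens_indexK.
rewrite !mxE; apply: eq_bigr => d _; rewrite mxE.
case: ltnP => // jd; rewrite (block_lower_triangular_entry V_lower) ?mul0r //.
exact: leq_trans cj jd.
Qed.

Lemma block_sof_gain_mx q m p (F : nat -> nat -> 'M[R]_(m, p)) (i j : 'I_q) :
  block (sof_gain_mx q F) i j = if (j <= i)%N then F i (i - j)%N else 0.
Proof.
by apply/matrixP => c d; rewrite !mxE !mxtens_indexK; case: ifP; rewrite ?mxE.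
Qed.

Lemma block_lower_triangular_sof_gain q m p (X : 'M[R]_(q * m, q * p)) :
  block_lower_triangular X ->
  exists F : nat -> nat -> 'M[R]_(m, p), X = sof_gain_mx q F.
Proof.
case: q X => [|q] X X_lower.
  by exists (fun _ _ => 0); apply/matrixP => -[].
(* The gain with delay i in block row k multiplies the output at step k - i. *)
exists (fun k i => block X (inord k) (inord (k - i))).
apply/matrixP => c d.
case: (mxtens_indexP c) => i k; case: (mxtens_indexP d) => j l.
rewrite [RHS]mxE !mxtens_indexK; case: leqP => ij; last first.
  by rewrite (block_lower_triangular_entry X_lower) ?mxtens_indexK.
by rewrite subKn // !inord_val !mxE.
Qed.

(** The memory of the controller never reaches behind the current period, so the
    inputs of a period are a block triangular function of its outputs. *)
Lemma sof_control_block N n m p (C : 'M[R]_(p, n))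
    (F : nat -> nat -> 'M[R]_(m, p)) (x : nat -> 'cV[R]_n) l (i : 'I_N) :
  vblock (sof_gain_mx N F *m (1%:M *t C
            *m vstack (fun j : 'I_N => x (l * N + j)%N))) i =
  sof_control N C F x (l * N + i)%N.
Proof.
rewrite vblock_mulmx /sof_control modnMDl modn_small //.
under eq_bigr => j _ do
  rewrite block_sof_gain_mx vblock_tens1mx vstackK (fun_if (mulmx^~ _)) mul0mx.
transitivity (\sum_(j < i.+1) F i (i - j)%N *m (C *m x (l * N + j)%N)).
  rewrite (big_ord_widen N (fun j => F i (i - j)%N *m (C *m x (l * N + j)%N))) //.
  by rewrite -big_mkcond.
rewrite (reindex_inj rev_ord_inj); apply: eq_bigr => j _ /=.
have ji : (j <= i)%N by rewrite -ltnS.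
by rewrite subSS subKn // addnBA.
Qed.

End Triangular.

(** * The LMI as a dissipation inequality over one period *)

Section Dissipation.
Context {R : realType} (q : nat) {n m p : nat}.
Variables (A : 'M[R]_n) (B : 'M[R]_(n, m)) (C : 'M[R]_(p, n)).

Lemma mulmx_castl a a' b c (e : a = a') (X : 'M[R]_(a, b)) (Y : 'M[R]_(b, c)) :
  castmx (e, erefl) X *m Y = castmx (e, erefl) (X *m Y).
Proof. by case: _ / e. Qed.

Lemma vblock_Pimx (X : 'cV[R]_(q.+1 * n)) (U : 'cV[R]_(q.+1 * m)) i :
  vblock (Pimx q.+1 A B *m col_mx X U : 'cV_(q.+2 * n)) i =
  if unlift ord0 i is Some j then A *m vblock X j + B *m vblock U j
  else vblock X ord0.
Proof.
rewrite mulmx_castl mul_block_col mul0mx addr0 vblock_cast_col.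
case: unliftP => [j|] _; first by rewrite vblockD !vblock_tens1mx.
rewrite vblock_tensmx (bigD1 ord0) //= big1 ?addr0 => [|j j0].
  by rewrite !mxE scale1r mul1mx.
by rewrite !mxE (negPf (j0 : j.+1 != 1)) scale0r.
Qed.

(** The first block row of D (X, U) is M Y - V11 U plus V12 times the residual of
    the state equations inside the period, and the second is V22 times that
    residual. *)
Lemma Dmx_trajectory M V11 V12 V22 (X : 'cV[R]_(q.+1 * n))
    (U : 'cV[R]_(q.+1 * m)) :
  V11 *m U = M *m (1%:M *t C *m X) ->
  (forall i : 'I_q, vblock X (lift ord0 i) =
     A *m vblock X (widen_ord (leqnSn q) i)
     + B *m vblock U (widen_ord (leqnSn q) i)) ->
  Dmx q.+1 A B C M V11 V12 V22 *m col_mx X U = 0.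
Proof.
move=> sof dyn.
have dyn0 : Lmx q q.+1 *t A *m X - Rmx q q.+1 *t 1%:M *m X
    + Lmx q q.+1 *t B *m U = 0.
  apply: vblockP => i; rewrite !vblockD vblockN !vblock_Lmx vblock_Rmx vblock0.
  by rewrite mul1mx dyn addrAC subrr.
rewrite mul_block_col !(mulmxDl, mulNmx) -!mulmxA -sof.
rewrite (_ : _ + _ = V12 *m (Lmx q q.+1 *t A *m X - Rmx q q.+1 *t 1%:M *m X
    + Lmx q q.+1 *t B *m U)); last first.
  (* The two copies of V11 U cancel. *)
  rewrite !mulmxDr mulmxN -[X in X + _]addrA addrACA.
  by rewrite [V11 *m U - _]subrr add0r.
rewrite -mulmxBr -mulmxDr dyn0 !mulmx0; exact: col_mx0.
Qed.

(** The strict inequality of the LMI is upgraded to a uniform one by coercivity.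
    On trajectories D vanishes, so He (H^T D) contributes 0. *)
Lemma lmi_dissipation P M V11 V12 V22 H :
  negdef ((Pimx q.+1 A B)^T *m Xmx q.+1 P 1 *m Pimx q.+1 A B
          + He (H^T *m Dmx q.+1 A B C M V11 V12 V22)) ->
  exists2 c : R, 0 < c & forall X U,
    V11 *m U = M *m (1%:M *t C *m X) ->
    (forall i : 'I_q, vblock X (lift ord0 i) =
       A *m vblock X (widen_ord (leqnSn q) i)
       + B *m vblock U (widen_ord (leqnSn q) i)) ->
    c * `|X| ^+ 2 <= qform P (vblock X ord0)
      - qform P (A *m vblock X ord_max + B *m vblock U ord_max).
Proof.
set Q := (_ + _) => -[Q_sym Q_neg].
have /posdef_coercive[c c_gt0 c_le] : posdef (- Q).
  split=> [|v v0]; first by rewrite linearN /= Q_sym.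
  by rewrite -/(qform _ _) qformN oppr_gt0 Q_neg.
exists c => // X U sof dyn.
have Dv0 := Dmx_trajectory V12 V22 sof dyn.
have := c_le (col_mx X U).
rewrite qformN qformD qform_He {2}/qform -!mulmxA Dv0 !mulmx0 mxE mul0rn addr0.
rewrite {1}/qform -!mulmxA mulmxA -trmx_mul mulmxA -/(qform _ _) qform_Xmx opprB.
rewrite !vblock_Pimx unlift_none.
have -> : ord_max = lift ord0 (ord_max : 'I_q.+1) by apply: val_inj.
rewrite liftK; apply: le_trans.
by rewrite ler_pM2l // lerXn2r ?nnegrE // col_mx_norm_le.
Qed.

End Dissipation.

(** * From decay over each period to asymptotic stability *)

Section Stability.
Context {R : realType} (N : nat) {n m p : nat}.
Hypothesis N_gt0 : (0 < N)%N.
Variables (A : 'M[R]_n) (B : 'M[R]_(n, m)) (C : 'M[R]_(p, n)).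
Variable F : nat -> nat -> 'M[R]_(m, p).

(** Each step only uses states from the start of its period on, which is at or
    after the start k0 - k0 %% N of the period of k0; so one more step costs one
    more constant factor. *)
Lemma finite_horizon_bound (k0 T : nat) :
  exists2 K : R, 0 < K & forall x delta, closed_loop_from N A B C k0 F x ->
    (forall j, (j <= k0 %% N)%N -> `|x (k0 - j)%N| <= delta) ->
    forall k, (k0 - k0 %% N <= k <= k0 + T)%N -> `|x k| <= K * delta.
Proof.
elim: T => [|T [K K_gt0 K_le]].
  exists 1 => // x delta _ x_le k; rewrite addn0 leq_subCl mul1r.
  by case/andP => kr kk0; rewrite -(subKn kk0) x_le.
set r := ((k0 + T) %% N)%N.
pose s := \sum_(i < r.+1) entry_norm_sum (B *m F r i *m C).
have s_ge0 : 0 <= s by apply: sumr_ge0 => i _; apply: entry_norm_sum_ge0.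
have A_ge0 := entry_norm_sum_ge0 A.
exists ((1 + entry_norm_sum A + s) * K).
  by rewrite mulr_gt0 // -addrA ltr_pwDl // addr_ge0.
move=> x delta x_loop x_le k.
have {}K_le := K_le x delta x_loop x_le.
have delta_ge0 : 0 <= delta by apply: le_trans (x_le 0%N _).
have Kd_ge0 : 0 <= K * delta by rewrite mulr_ge0 // ltW.
rewrite -mulrA; case/andP => k_ge.
rewrite addnS leq_eqVlt ltnS => /orP[/eqP->|k_le]; last first.
  apply: le_trans (K_le k _) _; first by rewrite k_ge.
  by rewrite ler_peMl // -addrA lerDl addr_ge0.
rewrite x_loop ?leq_addr // mulmx_sumr.
rewrite !mulrDl mul1r -addrA ler_wpDl // (le_trans (ler_normD _ _)) // lerD //.
  apply: le_trans (norm_mulmx_le _ _) _.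
  rewrite ler_wpM2l // K_le //; apply/andP; split=> //.
  exact: leq_trans (leq_subr _ _) (leq_addr _ _).
apply: le_trans (ler_norm_sum _ _ _) _; rewrite mulr_suml ler_sum // => i _.
rewrite !mulmxA; apply: le_trans (norm_mulmx_le _ _) _.
rewrite ler_wpM2l ?entry_norm_sum_ge0 // K_le //.
apply/andP; split; last exact: leq_subr.
have i_le : (i <= r)%N by rewrite -ltnS.
apply: leq_trans (leq_sub2l _ i_le).
rewrite /r [X in (X - k0 %% N)%N](divn_eq k0 N) addnK.
rewrite [X in (_ <= X - _)%N](divn_eq (k0 + T) N) addnK.
by rewrite leq_mul2r leq_div2r ?leq_addr ?orbT.
Qed.

Variables (P : 'M[R]_n) (c : R).
Hypotheses (P_pos : posdef P) (c_gt0 : 0 < c).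
Hypothesis dissipation : forall k0 x l j, closed_loop_from N A B C k0 F x ->
  (k0 <= l * N)%N -> (j < N)%N ->
  c * `|x (l * N + j)%N| ^+ 2 <=
    qform P (x (l * N)%N) - qform P (x (l.+1 * N)%N).

(** Let W be the form of P.  With W <= K |.|^2, dissipation gives
    W' <= W - (c / K) W at consecutive boundaries.  Taking
    K = C0 + c, where W <= C0 |.|^2 and C0 >= 0, makes the ratio
    1 - c / K = C0 / K lie in [0, 1). *)
Lemma periodic_decay :
  exists K rho : R, [/\ 0 < K, 0 <= rho < 1 &
    forall k0 x l1 l j, closed_loop_from N A B C k0 F x ->
      (k0 <= l1 * N)%N -> (j < N)%N ->
      `|x ((l1 + l) * N + j)%N| ^+ 2 <= K * rho ^+ l * `|x (l1 * N)%N| ^+ 2].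
Proof.
have [C0 C0_ge0 C0_le] := qform_le P; pose K := C0 + c.
have K_gt0 : 0 < K by rewrite ltr_wpDl.
have W_le v : qform P v <= K * `|v| ^+ 2.
  by apply: le_trans (C0_le v) _; rewrite ler_wpM2r ?sqr_ge0 // lerDl ltW.
exists (K / c), (C0 / K); split; first by rewrite divr_gt0.
  by rewrite divr_ge0 ?(ltW K_gt0) //= ltr_pdivrMr // mul1r ltrDl.
move=> k0 x l1 l j x_loop k0_le jN.
have l1_le i : (k0 <= (l1 + i) * N)%N.
  by apply: leq_trans k0_le _; rewrite leq_mul2r leq_addr orbT.
have W_decay : qform P (x ((l1 + l) * N)%N)
    <= (C0 / K) ^+ l * qform P (x (l1 * N)%N).
  elim: l => [|l IHl]; first by rewrite addn0 mul1r.
  rewrite exprS -mulrA; apply: le_trans (ler_wpM2l _ IHl); last first.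
    by rewrite divr_ge0 ?(ltW K_gt0).
  have := dissipation x_loop (l1_le l) N_gt0; rewrite addn0 addnS.
  set w := qform P (x ((l1 + l) * N)%N); set w' := qform _ _; move=> w'_le.
  have w_le : w <= K * `|x ((l1 + l) * N)%N| ^+ 2 := W_le _.
  rewrite mulrAC ler_pdivlMr // mulrC.
  rewrite -(ler_pM2l K_gt0) in w'_le.
  have := ler_wpM2l (ltW c_gt0) w_le.
  rewrite /K in w'_le *; lra.
rewrite mulrAC -mulrA -mulrA [c^-1 * _]mulrC mulrA ler_pdivlMr // mulrC.
apply: le_trans (dissipation x_loop (l1_le l) jN) _.
apply: le_trans (_ : qform P (x ((l1 + l) * N)%N) <= _).
  by rewrite gerBl posdef_ge0.
apply: le_trans W_decay _; rewrite mulrA [leRHS]mulrC.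
by rewrite ler_wpM2l ?W_le // exprn_ge0 // divr_ge0 // ltW.
Qed.

(** The first period boundary after k0 is at most N steps away, so
    [finite_horizon_bound] reaches it and [periodic_decay] takes over from
    there.  The squares are kept on both sides, with the factor (1 + K)^2 >= K,
    to avoid the square root of K. *)
Lemma exponential_bound k0 :
  exists D rho : R, [/\ 0 < D, 0 <= rho < 1 &
    forall x delta, closed_loop_from N A B C k0 F x ->
    (forall j, (j <= k0 %% N)%N -> `|x (k0 - j)%N| <= delta) ->
    (forall k, (k0 <= k)%N -> `|x k| <= D * delta)
    /\ (forall k, ((k0 %/ N).+1 * N <= k)%N ->
          `|x k| ^+ 2 <= rho ^+ (k %/ N - (k0 %/ N).+1) * (D * delta) ^+ 2)].
Proof.
have [K [rho [K_gt0 rho_bd decay]]] := periodic_decay.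
have [K' K'_gt0 horizon] := finite_horizon_bound k0 N.
have /andP[rho_ge0 rho_lt1] := rho_bd.
exists ((1 + K) * K'), rho; split=> // [|x delta x_loop x_le].
  by rewrite mulr_gt0 // addr_gt0.
set l1 := (k0 %/ N).+1.
have {}horizon := horizon x delta x_loop x_le.
have delta_ge0 : 0 <= delta by apply: le_trans (x_le 0%N _).
have Kd_ge0 : 0 <= K' * delta by rewrite mulr_ge0 // ltW.
have k0_le : (k0 <= l1 * N)%N by rewrite ltnW // ltn_ceil.
have l1_le : (l1 * N <= k0 + N)%N.
  by rewrite mulSn addnC leq_add2r leq_divM.
have late k : (l1 * N <= k)%N ->
    `|x k| ^+ 2 <= rho ^+ (k %/ N - l1) * ((1 + K) * K' * delta) ^+ 2.
  move=> k_ge; have l1k : (l1 <= k %/ N)%N by rewrite leq_divRL.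
  have := decay k0 x l1 (k %/ N - l1)%N (k %% N)%N x_loop k0_le
    (ltn_pmod k N_gt0).
  rewrite subnKC // -divn_eq => /le_trans; apply.
  rewrite [K * _]mulrC -[leLHS]mulrA ler_wpM2l ?exprn_ge0 //.
  rewrite -mulrA exprMn; apply: ler_pM; rewrite ?(ltW K_gt0) ?sqr_ge0 //.
    by have := sqr_ge0 K; nra.
  rewrite lerXn2r ?nnegrE // horizon // l1_le andbT.
  exact: leq_trans (leq_subr _ _) k0_le.
split=> // k k_ge.
have [/late|k_lt] := leqP (l1 * N)%N k; last first.
  rewrite -mulrA; apply: le_trans (horizon k _) _.
    by rewrite (leq_trans (leq_subr _ _)) //= (leq_trans (ltnW k_lt)).
  by rewrite ler_peMl // lerDl ltW.
move=> x_late; have D_ge0 : 0 <= (1 + K) * K' * delta.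
  by rewrite -mulrA mulr_ge0 // addr_ge0 // ltW.
rewrite -(ler_pXn2r (n := 2)) ?nnegrE //; apply: le_trans x_late _.
by rewrite ler_piMl ?sqr_ge0 // exprn_ile1 // ltW.
Qed.

Lemma dissipation_asymptotically_stable : asymptotically_stable N A B C F.
Proof.
split=> [k0 eps eps_gt0|k0 x x_loop].
  have [D [rho [D_gt0 _ bound]]] := exponential_bound k0.
  have D1_gt0 : 0 < D + 1 by rewrite addr_gt0.
  exists (eps / (D + 1)); first by rewrite divr_gt0.
  move=> x x_loop x_lt k k_ge.
  have [|x_le _] := bound x (eps / (D + 1)) x_loop.
    by move=> j /x_lt/ltW.
  apply: le_lt_trans (x_le k k_ge) _.
  by rewrite mulrCA gtr_pMr // ltr_pdivrMr // mul1r ltrDl.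
have [D [rho [D_gt0 rho_bd bound]]] := exponential_bound k0.
pose delta := \sum_(j < (k0 %% N).+1) `|x (k0 - j)%N|.
have [|_ x_late] := bound x delta x_loop.
  move=> j j_le; rewrite /delta (bigD1 (inord j)) //= inordK ?ltnS //.
  by rewrite lerDl sumr_ge0.
apply/cvgr0Pnorm_lt => eps eps_gt0.
have rho_norm : `|rho| < 1 by case/andP: rho_bd => r0 r1; rewrite ger0_norm.
have b_gt0 : 0 < (D * delta) ^+ 2 + 1 by rewrite ltr_wpDl ?sqr_ge0.
have /cvgr0Pnorm_lt/(_ (eps ^+ 2 / ((D * delta) ^+ 2 + 1))) := cvg_expr rho_norm.
case; first by rewrite divr_gt0 ?exprn_gt0.
move=> L _ rho_lt.
exists (((k0 %/ N).+1 + L) * N)%N => // k /= k_ge.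
have k_div : ((k0 %/ N).+1 + L <= k %/ N)%N by rewrite leq_divRL.
have k_ge1 : ((k0 %/ N).+1 * N <= k)%N.
  by apply: leq_trans k_ge; rewrite leq_mul2r leq_addr orbT.
rewrite -(ltr_pXn2r (n := 2)) ?nnegrE ?(ltW eps_gt0) //.
apply: le_lt_trans (x_late k k_ge1) _.
have /rho_lt /= : (L <= k %/ N - (k0 %/ N).+1)%N.
  by rewrite leq_subRL // (leq_trans (leq_addr _ _) k_div).
rewrite ltr_pdivlMr // ger0_norm ?exprn_ge0 //; last by case/andP: rho_bd.
apply: le_lt_trans; rewrite ler_wpM2l ?lerDl ?exprn_ge0 //.
by case/andP: rho_bd.
Qed.

End Stability.

(** * Stabilization *)

Theorem corollary2 (R : realType) (N n m p : nat)
    (N_gt0 : (0 < N)%N) (n_gt0 : (0 < n)%N) (m_gt0 : (0 < m)%N)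
    (p_gt0 : (0 < p)%N)
    (A : 'M[R]_n) (B : 'M[R]_(n, m)) (C : 'M[R]_(p, n))
    (Phat : 'M[R]_n) (Jhat : 'M[R]_(N * m, N * n)) (Ghat : 'M[R]_(N * n))
    (hat_sol : sf_lmi_solution N A B Phat Jhat Ghat)
    (P : 'M[R]_n) (M : 'M[R]_(N * m, N * p)) (V11 : 'M[R]_(N * m))
    (V12 : 'M[R]_(N * m, N.-1 * n)) (V22 : 'M[R]_(N.-1 * n))
    (P_sym : P^T = P)
    (M_lower : block_lower_triangular M)
    (V11_lower : block_lower_triangular V11)
    (P_pos : posdef P)
    (lmi : negdef ((Pimx N A B)^T *m Xmx N P 1 *m Pimx N A B
                   + He ((Hmx N A B (sf_gain_mx N Jhat Ghat))^T
                         *m Dmx N A B C M V11 V12 V22)))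
    (V11_neg : negdef (He V11)) :
  periodic_sof_stabilizable N A B C
  /\ V11 \in unitmx
  /\ stabilizing_gain_mx N A B C (invmx V11 *m M).
Proof.
case: N N_gt0 Jhat Ghat hat_sol M V11 V12 V22 M_lower V11_lower lmi V11_neg
  => [//|q] _ J G _ {}M {}V11 {}V12 {}V22 {}M_lower {}V11_lower {}lmi {}V11_neg.
have V11_def v : v != 0 -> qform V11 v != 0.
  have [_ He_lt0] := V11_neg; move=> /He_lt0; rewrite -/(qform _ _) qform_He.
  by rewrite pmulrn_llt0 //; apply: ltr0_neq0.
have V11_unit : V11 \in unitmx by apply: unitmx_qform_neq0.
have gain_lower : block_lower_triangular (invmx V11 *m M).
  by apply: block_lower_triangular_divl V11_def V11_lower _; rewrite mulKVmx.
have [F F_def] := block_lower_triangular_sof_gain gain_lower.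
suff F_stable : asymptotically_stable q.+1 A B C F.
  by split; [exists F | split; last exists F].
have [c c_gt0 c_le] := lmi_dissipation lmi.
apply: (dissipation_asymptotically_stable _ P_pos c_gt0) => //.
move=> k0 x l j x_loop k0_le j_lt.
pose X : 'cV[R]_(q.+1 * n) := vstack (fun i : 'I_q.+1 => x (l * q.+1 + i)%N).
pose U : 'cV[R]_(q.+1 * m) := invmx V11 *m M *m (1%:M *t C *m X).
have step (i : 'I_q.+1) :
    x (l * q.+1 + i.+1)%N = A *m vblock X i + B *m vblock U i.
  rewrite addnS x_loop ?(leq_trans k0_le) ?leq_addr //.
  by rewrite /U F_def sof_control_block vstackK.
have := c_le X U.
rewrite -step vstackK addn0 -mulSnr => dissip.
apply: le_trans (dissip _ _) => [||i].
- rewrite ler_pM2l // lerXn2r ?nnegrE //.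
  by have := vblock_norm_le X (Ordinal j_lt); rewrite vstackK.
- by rewrite /U !mulmxA mulmxV // mul1mx.
- by rewrite -step vstackK.
Qed.
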